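(* Let $\alpha>0$ be a constant and let $\delta(\varepsilon)>0$ be any function with $\delta(\varepsilon)\to0$ as $\varepsilon\to0+$ and $\delta(\varepsilon)\ge\alpha\varepsilon$. Then there is a constant $\beta>0$ independent of $c$ and $\varepsilon$ such that for each $c\in(c_-,c_+)$, the uniform limit $v^\ast=\lim_{\varepsilon\to0+}v^\varepsilon$ satisfies $$|v^\varepsilon(x)-v^\ast(x)|\le\beta\big(\varepsilon|\log\delta(\varepsilon)|^2+\delta(\varepsilon)\big)\quad\text{for all }x\in\mathbb{T}$$ as $\varepsilon\to0+$ (i.e. for all sufficiently small $\varepsilon>0$).
   Context: Here $n=1$, $\mathbb{T}=\mathbb{R}/\mathbb{Z}$, and $H(x,p)=\frac12p^2-F(x)$ with $F\in C^2(\mathbb{T})$, $F\ge0$, where $F$ has finitely many zeros $0\le x_1<\dots<x_I<1$ and $F_{xx}(x_i)>0$ for each $i$. Set $c_\pm:=\pm\int_{\mathbb{T}}\sqrt{2F(x)}\,dx$. For $c\in(c_-,c_+)$ the effective Hamiltonian is $h(c)=0$, i.e. $0$ is the unique constant for which $\frac12(c+v_x)^2-F(x)=h(c)$ has a viscosity solution on $\mathbb{T}$. For $\varepsilon>0$, $v^\varepsilon$ is the unique viscosity solution of $\varepsilon v^\varepsilon+\frac12(c+v^\varepsilon_x)^2-F(x)=0$ on $\mathbb{T}$. It is known that $v^\varepsilon$ converges uniformly on $\mathbb{T}$ as $\varepsilon\to0+$ to a viscosity solution $v^\ast$ of $\frac12(c+v_x)^2-F(x)=0$. *)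

(* Defs.v *)
From Stdlib Require Import Reals Lra List.
From Coquelicot Require Import Coquelicot.
Open Scope R_scope.

(* 1-periodic functions R -> R represent functions on T = R/Z. *)
Definition periodic1 (u : R -> R) : Prop := forall x, u (x + 1) = u x.

Definition C1 (phi : R -> R) : Prop :=
  (forall x, ex_derive phi x) /\ (forall x, continuous (Derive phi) x).

Definition admissible_F (F : R -> R) : Prop :=
  periodic1 F /\
  (forall x, ex_derive F x) /\
  (forall x, ex_derive (Derive F) x) /\
  (forall x, continuous (Derive_n F 2) x) /\
  (forall x, 0 <= F x) /\
  (exists zs : list R, zs <> nil /\
     forall x, 0 <= x < 1 -> (F x = 0 <-> In x zs)) /\
  (forall x, F x = 0 -> 0 < Derive_n F 2 x).

(* c_+ = int_T sqrt(2F);  c_- = - c_+ *)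
Definition c_plus (F : R -> R) : R := RInt (fun x => sqrt (2 * F x)) 0 1.

Definition visc_sub (G : R -> R -> R -> R) (u : R -> R) : Prop :=
  forall (phi : R -> R) (x0 : R), C1 phi ->
    (exists r, 0 < r /\ forall y, Rabs (y - x0) < r ->
        u y - phi y <= u x0 - phi x0) ->
    G x0 (u x0) (Derive phi x0) <= 0.

Definition visc_super (G : R -> R -> R -> R) (u : R -> R) : Prop :=
  forall (phi : R -> R) (x0 : R), C1 phi ->
    (exists r, 0 < r /\ forall y, Rabs (y - x0) < r ->
        u x0 - phi x0 <= u y - phi y) ->
    0 <= G x0 (u x0) (Derive phi x0).

Definition visc_sol_T (G : R -> R -> R -> R) (u : R -> R) : Prop :=
  periodic1 u /\ (forall x, continuous u x) /\ visc_sub G u /\ visc_super G u.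

Definition G_disc (F : R -> R) (c eps : R) : R -> R -> R -> R :=
  fun x v p => eps * v + / 2 * (c + p) ^ 2 - F x.

(* Main.v *)
From Stdlib Require Import ZArith Reals Lra Lia List Classical.
From Coquelicot Require Import Coquelicot.
(* Last, so that [C1] is not shadowed by Stdlib's [Cos_rel.C1]. *)
Require Import Defs.
Open Scope R_scope.

(* Write [A] for an antiderivative of [sqrt (2 F)]. For small [eps], [v eps x] equals the minimum
   over the zeros [z] of [F] within distance 2 of [x] of [|A x - A z| - c (x - z)], up to
   [O (eps (1 - ln eps))] with a constant independent of [c]; comparing two values of [eps] and
   letting one tend to 0 gives the rate for [v eps - vstar], and [eps (1 - ln eps)] is dominated by
   [eps (ln d)^2 + d] for every [d > 0].

   Upper bound: [v eps z <= 0] at a zero [z], and [v eps] is bounded below, so [v eps] is a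
   subsolution of [(c + v')^2 <= 2 F + O(eps)]. As [sqrt (2 F)] grows linearly away from the zeros,
   adding to [A] the small multiple [eps D] of [ln (t + sqrt (t^2 + eps))], centred at finitely many
   zeros, gives a C1 function with a strictly larger slope, which therefore dominates [v eps].

   Lower bound: minimise over [[x - 1, x + 1]] the sum of [v eps y + c y] and a smoothed
   [|A y - A x - B eps (y - x)|]. Since [|c| < c_plus F] the minimum is interior, and the
   supersolution property there, combined with [v eps <= O(sqrt F)], forces the minimum point to lie
   within [O(eps)] of a zero of [F] with [v eps >= - O(eps)] at that point. *)

(** * Calculus and periodicity preliminaries *)

Lemma C1_intro (f f' : R -> R) :
  (forall x : R, is_derive f x (f' x)) -> (forall x : R, continuous f' x) -> C1 f.
Proof.
  intros Hd Hc; split.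
  - intros x; exists (f' x); apply Hd.
  - intros x; apply continuous_ext with f'; [|apply Hc].
    intros y; symmetry; apply is_derive_unique, Hd.
Qed.

Lemma continuous_of_is_derive (f : R -> R) (x : R) l : is_derive f x l -> continuous f x.
Proof. intros H; apply (ex_derive_continuous f); exists l; exact H. Qed.

Lemma continuous_Rplus (f g : R -> R) (x : R) :
  continuous f x -> continuous g x -> continuous (fun y => f y + g y) x.
Proof. apply (continuous_plus f g). Qed.

Lemma continuous_Rminus (f g : R -> R) (x : R) :
  continuous f x -> continuous g x -> continuous (fun y => f y - g y) x.
Proof. apply (continuous_minus f g). Qed.

Lemma continuous_Rmult (f g : R -> R) (x : R) :
  continuous f x -> continuous g x -> continuous (fun y => f y * g y) x.
Proof. apply (continuous_mult f g). Qed.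

Lemma continuous_near (f : R -> R) (x : R) e :
  continuous f x -> 0 < e ->
  exists r, 0 < r /\ forall y, Rabs (y - x) < r -> Rabs (f y - f x) < e.
Proof.
  intros Hc He.
  destruct (proj1 (filterlim_locally f (f x)) Hc (mkposreal e He)) as [r Hr].
  exists r; split; [apply cond_pos|].
  intros y Hy; apply (Hr y Hy).
Qed.

Lemma continuous_max (f : R -> R) a b :
  a <= b -> (forall x : R, continuous f x) ->
  exists x, a <= x <= b /\ forall y, a <= y <= b -> f y <= f x.
Proof.
  intros Hab Hc.
  destruct (continuity_ab_maj f a b Hab) as [x [H1 H2]].
  - intros y _; apply continuity_pt_filterlim, Hc.
  - exists x; split; [exact H2|exact H1].
Qed.

Lemma continuous_min (f : R -> R) a b :
  a <= b -> (forall x : R, continuous f x) ->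
  exists x, a <= x <= b /\ forall y, a <= y <= b -> f x <= f y.
Proof.
  intros Hab Hc.
  destruct (continuous_max (fun y => - f y) a b Hab) as [x [H1 H2]].
  - intros y; apply (continuous_opp f), Hc.
  - exists x; split; [exact H1|]. intros y Hy; specialize (H2 y Hy); lra.
Qed.

Lemma periodic1_IZR (f : R -> R) : periodic1 f -> forall n x, f (x + IZR n) = f x.
Proof.
  intros Hp.
  assert (Hn : forall n x, f (x + INR n) = f x).
  { induction n as [|n IH]; intros x.
    - simpl; f_equal; ring.
    - rewrite S_INR, <- Rplus_assoc, Hp; apply IH. }
  intros [|p|p] x.
  - f_equal; ring.
  - rewrite <- (positive_nat_Z p), <- INR_IZR_INZ; apply Hn.
  - rewrite <- Pos2Z.opp_pos, opp_IZR, <- (positive_nat_Z p), <- INR_IZR_INZ.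
    rewrite <- (Hn (Pos.to_nat p)); f_equal; ring.
Qed.

Lemma integer_translate (x : R) : exists n, 0 <= x + IZR n <= 1.
Proof.
  destruct (archimed x) as [H1 H2].
  (* [up x] lies in [(x, x + 1]], so the shift by [1 - up x] lands in [[0, 1)]. *)
  exists (1 - up x)%Z; rewrite minus_IZR; lra.
Qed.

Lemma periodic1_bounded (f : R -> R) :
  periodic1 f -> (forall x : R, continuous f x) -> exists M, forall x, f x <= M.
Proof.
  intros Hp Hc.
  destruct (continuous_max f 0 1) as [x0 [_ H]]; [lra|exact Hc|].
  exists (f x0); intros x.
  destruct (integer_translate x) as [n Hn].
  rewrite <- (periodic1_IZR f Hp n x); apply H, Hn.
Qed.

(** * Test functions touching from above, with control of the slope *)

(* The exponential penalty makes the maximum of [v - psi] interior and only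
   increases the slope of the test function. *)
Lemma touch_right (v phi phi' : R -> R) a b d m :
  (forall x : R, continuous v x) ->
  (forall x : R, is_derive phi x (phi' x)) -> (forall x : R, continuous phi' x) ->
  a < b -> 0 < d -> v a - phi a <= m -> m < v b - phi b ->
  exists psi x, C1 psi /\ a < x < b + d /\
    (exists r, 0 < r /\ forall y, Rabs (y - x) < r -> v y - psi y <= v x - psi x) /\
    phi' x < Derive psi x /\ m < v x - phi x.
Proof.
  intros Hv Hphi Hphi' Hab Hd Ha Hb.
  (* Half of the excess over [m] at [b]: the penalty at [b] equals [kap], so [v b - psi b] still
     exceeds [m] by [kap]. *)
  set (kap := (v b - phi b - m) / 2).
  assert (Hk : 0 < kap) by (unfold kap; lra).
  set (X := v (b + d) - phi (b + d) - (v b - phi b)).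
  (* With this rate the penalty grows from [b] to [b + d] by at least [|X| + 1], more than [v - phi]
     can gain there. *)
  set (N := (Rabs X + 1) / (kap * d)).
  assert (HN : 0 < N).
  { apply Rdiv_lt_0_compat; [pose proof (Rabs_pos X); lra|].
    apply Rmult_lt_0_compat; assumption. }
  assert (HNd : kap * (N * d) = Rabs X + 1) by (unfold N; field; lra).
  set (psi := fun y => phi y + kap * exp (N * (y - b))).
  set (psi' := fun y => phi' y + kap * N * exp (N * (y - b))).
  assert (Dpsi : forall x : R, is_derive psi x (psi' x)).
  { intros x. unfold psi, psi'.
    apply (is_derive_plus phi (fun y => kap * exp (N * (y - b)))); [apply Hphi|].
    auto_derive; [exact I|unfold Rminus; ring]. }
  assert (Cpsi : C1 psi).
  { apply C1_intro with psi'; [exact Dpsi|].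
    intros x; apply continuous_Rplus; [apply Hphi'|].
    apply (ex_derive_continuous (fun y => kap * N * exp (N * (y - b)))); auto_derive; exact I. }
  destruct (continuous_max (fun y => v y - psi y) a (b + d)) as [x [Hx Hmax]]; [lra| |].
  { intros x; apply continuous_Rminus; [apply Hv|].
    eapply continuous_of_is_derive, Dpsi. }
  assert (Eb : psi b = phi b + kap).
  { unfold psi; replace (N * (b - b)) with 0 by ring; rewrite exp_0; ring. }
  assert (Ea : phi a < psi a).
  { unfold psi; pose proof (Rmult_lt_0_compat _ _ Hk (exp_pos (N * (a - b)))); lra. }
  assert (Ed : phi (b + d) + kap * (1 + N * d) <= psi (b + d)).
  { unfold psi; replace (N * (b + d - b)) with (N * d) by ring.
    apply Rplus_le_compat_l, Rmult_le_compat_l; [lra|].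
    left; apply exp_ineq1. apply Rgt_not_eq, Rmult_lt_0_compat; assumption. }
  pose proof (Hmax b ltac:(lra)) as Hmb. simpl in Hmb.
  assert (Hvb : v b - phi b = m + 2 * kap) by (unfold kap; lra).
  assert (Hxa : x <> a) by (intros ->; lra).
  assert (Hxd : x <> b + d).
  { intros ->. pose proof (Rle_abs X). unfold X in *; lra. }
  assert (Hx' : a < x < b + d).
  { destruct Hx as [[?|?] [?|?]]; try congruence; lra. }
  exists psi, x; repeat split; try apply Cpsi; try lra.
  - exists (Rmin (x - a) (b + d - x)); split.
    + apply Rmin_pos; lra.
    + intros y Hy; apply Hmax.
      pose proof (Rmin_l (x - a) (b + d - x)); pose proof (Rmin_r (x - a) (b + d - x)).
      apply Rabs_def2 in Hy; lra.
  - rewrite (is_derive_unique _ _ _ (Dpsi x)); unfold psi'.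
    assert (0 < kap * N * exp (N * (x - b))); [|lra].
    apply Rmult_lt_0_compat; [apply Rmult_lt_0_compat; assumption|apply exp_pos].
  - assert (phi x < psi x); [|lra].
    unfold psi; pose proof (Rmult_lt_0_compat _ _ Hk (exp_pos (N * (x - b)))); lra.
Qed.

Lemma is_derive_reflect (f : R -> R) (x : R) l :
  is_derive f (- x) l -> is_derive (fun y : R => f (- y)) x (- l).
Proof.
  intros H.
  replace (- l) with (scal (- 1) l) by (unfold scal; simpl; unfold mult; simpl; ring).
  apply (is_derive_comp f (fun y => - y)); [exact H|].
  auto_derive; [exact I|unfold Rminus; ring].
Qed.

Lemma continuous_reflect (f : R -> R) (x : R) :
  continuous f (- x) -> continuous (fun y : R => f (- y)) x.
Proof.
  intros H; apply (continuous_comp (fun y => - y) f); [|exact H].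
  apply (continuous_opp (fun y : R => y)), continuous_id.
Qed.

(** Mirror image of [touch_right] under [y -> - y], which reverses the sign of all slopes. *)
Lemma touch_left (v phi phi' : R -> R) a b d m :
  (forall x : R, continuous v x) ->
  (forall x : R, is_derive phi x (phi' x)) -> (forall x : R, continuous phi' x) ->
  b < a -> 0 < d -> v a - phi a <= m -> m < v b - phi b ->
  exists psi x, C1 psi /\ b - d < x < a /\
    (exists r, 0 < r /\ forall y, Rabs (y - x) < r -> v y - psi y <= v x - psi x) /\
    Derive psi x < phi' x /\ m < v x - phi x.
Proof.
  intros Hv Hphi Hphi' Hab Hd Ha Hb.
  destruct (touch_right (fun y => v (- y)) (fun y => phi (- y)) (fun y => - phi' (- y))
              (- a) (- b) d m) as (psi & x & [C C'] & Hx & (r & Hr & Hmax) & Hs & Hm);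
    rewrite ?Ropp_involutive; try lra.
  - intros x; apply continuous_reflect, Hv.
  - intros x; apply is_derive_reflect, Hphi.
  - intros x; apply (continuous_opp (fun y => phi' (- y))), continuous_reflect, Hphi'.
  - assert (D : forall y : R, is_derive (fun t : R => psi (- t)) y (- Derive psi (- y))).
    { intros y; apply is_derive_reflect, Derive_correct, C. }
    exists (fun y => psi (- y)), (- x); repeat split; try lra.
    + intros y; eexists; apply D.
    + intros y; apply continuous_ext with (fun y => - Derive psi (- y)).
      { intros t; symmetry; apply is_derive_unique, D. }
      apply (continuous_opp (fun y => Derive psi (- y))), continuous_reflect, C'.
    + exists r; split; [exact Hr|]. intros y Hy.
      rewrite Ropp_involutive. rewrite <- (Ropp_involutive y) at 1. apply Hmax.
      rewrite <- Rabs_Ropp; replace (- (- y - x)) with (y - - x) by ring; exact Hy.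
    + rewrite (is_derive_unique (fun t : R => psi (- t)) (- x) _ (D (- x))), Ropp_involutive; lra.
Qed.

(** * Speed and action *)

(** The value of [|c + p|] that solves the limit equation [(c + p)^2 / 2 = F x]; its integral
    [action] is the cost of travel between two points. *)
Definition speed (F : R -> R) (x : R) : R := sqrt (2 * F x).

Definition action (F : R -> R) (y : R) : R := RInt (speed F) 0 y.

Lemma speed_sqr (F : R -> R) x : 0 <= F x -> speed F x ^ 2 = 2 * F x.
Proof. intros H; apply pow2_sqrt; lra. Qed.

Lemma continuous_speed (F : R -> R) :
  (forall x : R, continuous F x) -> forall x : R, continuous (speed F) x.
Proof.
  intros H x; apply (continuous_comp (fun y => 2 * F y) sqrt).
  - apply continuous_Rmult; [apply continuous_const|apply H].
  - apply continuous_sqrt.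
Qed.

Lemma is_derive_action (F : R -> R) :
  (forall x : R, continuous F x) -> forall x : R, is_derive (action F) x (speed F x).
Proof.
  intros H x; apply is_derive_RInt with 0.
  - exists (mkposreal 1 Rlt_0_1); intros y _; apply @RInt_correct, ex_RInt_continuous.
    intros z _; apply continuous_speed, H.
  - apply continuous_speed, H.
Qed.

Lemma MVT_is_derive (f f' : R -> R) a b :
  (forall x : R, is_derive f x (f' x)) ->
  exists x, Rmin a b <= x <= Rmax a b /\ f b - f a = f' x * (b - a).
Proof.
  intros D; apply MVT_gen.
  - intros x _; apply D.
  - intros x _; apply continuity_pt_filterlim; eapply continuous_of_is_derive, D.
Qed.

(** The difference [action F (y + 1) - action F y] has zero derivative by periodicity and equals
    [c_plus F] at [y = 0]. *)
Lemma action_shift (F : R -> R) :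
  periodic1 F -> (forall x : R, continuous F x) ->
  forall x, action F (x + 1) = action F x + c_plus F.
Proof.
  intros Hp Hc x.
  destruct (MVT_is_derive (fun y => action F (y + 1) - action F y) (fun _ => 0) 0 x)
    as [y [_ Hy]].
  - intros y.
    replace 0 with (speed F (y + 1) - speed F y) by (unfold speed; rewrite Hp; ring).
    apply (is_derive_minus (fun y => action F (y + 1)) (action F));
      [|apply is_derive_action, Hc].
    replace (speed F (y + 1)) with (scal 1 (speed F (y + 1)))
      by (unfold scal; simpl; unfold mult; simpl; ring).
    apply (is_derive_comp (action F) (fun y => y + 1)); [apply is_derive_action, Hc|].
    auto_derive; [exact I|unfold Rminus; ring].
  - replace (action F 0) with 0 in Hy.
    2:{ unfold action; rewrite RInt_point; reflexivity. }
    replace (action F (0 + 1)) with (c_plus F) in Hy.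
    2:{ rewrite Rplus_0_l; reflexivity. }
    lra.
Qed.

Lemma action_le (F : R -> R) :
  (forall x : R, continuous F x) -> forall x y, x <= y -> action F x <= action F y.
Proof.
  intros Hc x y Hxy.
  destruct (MVT_is_derive _ _ x y (is_derive_action F Hc)) as [z [_ Hz]].
  assert (0 <= speed F z * (y - x)); [|lra].
  apply Rmult_le_pos; [apply sqrt_pos|lra].
Qed.

Lemma action_lipschitz (F : R -> R) M :
  (forall x : R, continuous F x) -> (forall x, speed F x <= M) ->
  forall x y, Rabs (action F x - action F y) <= M * Rabs (x - y).
Proof.
  intros Hc HM x y.
  destruct (MVT_is_derive _ _ y x (is_derive_action F Hc)) as [z [_ Hz]].
  rewrite Hz, Rabs_mult, (Rabs_pos_eq (speed F z)); [|apply sqrt_pos].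
  apply Rmult_le_compat_r; [apply Rabs_pos|apply HM].
Qed.

Lemma c_plus_ge_0 (F : R -> R) :
  periodic1 F -> (forall x : R, continuous F x) -> 0 <= c_plus F.
Proof.
  intros Hp Hc.
  pose proof (action_shift F Hp Hc 0); pose proof (action_le F Hc 0 (0 + 1)); lra.
Qed.

(** * Supersolution property at an interior minimum *)

(* The test function is [- sqrt (S^2 + sigma^2) - c y], a smoothed tent whose slope is at most
   [|S'|]; since [|c| < c_plus F], it lies below [v] one period away on either side. *)
Lemma descent_point (F : R -> R) c eps (v : R -> R) eta sigma x0 :
  periodic1 F -> (forall x : R, continuous F x) ->
  visc_sol_T (G_disc F c eps) v -> 0 < sigma -> Rabs c + sigma < c_plus F - eta ->
  exists y, x0 - 1 < y < x0 + 1 /\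
    2 * F y - (speed F y - eta) ^ 2 <= 2 * eps * v y /\
    v y + c * y + Rabs (action F y - action F x0 - eta * (y - x0)) - sigma <= v x0 + c * x0.
Proof.
  intros HpF HcF (Hpv & Hcv & _ & Hsup) Hsig Hc.
  (* The tilt [eta] replaces the slope [speed F] by [speed F - eta]; the resulting gap between
     squares is what bounds [v] from below at the minimum point. *)
  set (S := fun y => action F y - action F x0 - eta * (y - x0)).
  set (q := fun y => sqrt (S y ^ 2 + sigma ^ 2)).
  assert (HS : forall x : R, is_derive S x (speed F x - eta)).
  { intros x; unfold S.
    apply (is_derive_minus (fun y => action F y - action F x0) (fun y => eta * (y - x0))).
    - replace (speed F x) with (speed F x - 0) by ring.
      apply (is_derive_minus (action F) (fun _ => action F x0)).
      + apply is_derive_action, HcF.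
      + apply @is_derive_const.
    - auto_derive; [exact I|ring]. }
  assert (Hpos : forall t, 0 < t ^ 2 + sigma ^ 2).
  { intros t; pose proof (pow2_ge_0 t); pose proof (pow_lt sigma 2 Hsig); lra. }
  assert (Hq : forall y, Rabs (S y) <= q y).
  { intros y; unfold q; rewrite <- (sqrt_pow2 (Rabs (S y))) by apply Rabs_pos.
    rewrite pow2_abs; apply sqrt_le_1_alt; pose proof (pow2_ge_0 sigma); lra. }
  assert (Hq0 : forall y, 0 < q y) by (intros y; apply sqrt_lt_R0, Hpos).
  set (psi := fun y => - q y - c * y).
  set (psi' := fun y => - (S y / q y) * (speed F y - eta) - c).
  assert (Dpsi : forall x : R, is_derive psi x (psi' x)).
  { intros x; apply (is_derive_minus (fun y => - q y) (fun y => c * y)).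
    - replace (- (S x / q x) * (speed F x - eta))
        with (scal (speed F x - eta) (- (S x / q x)))
        by (unfold scal; simpl; unfold mult; simpl; ring).
      apply (is_derive_comp (fun t => - sqrt (t ^ 2 + sigma ^ 2)) S); [|apply HS].
      auto_derive; [rewrite Rmult_1_r; specialize (Hpos (S x)); simpl in Hpos; lra|].
      unfold q; simpl; field.
      specialize (Hq0 x); unfold q in Hq0; simpl in Hq0; lra.
    - auto_derive; [exact I|ring]. }
  assert (CS : forall x : R, continuous S x).
  { intros x; eapply continuous_of_is_derive, HS. }
  assert (Cq : forall x : R, continuous q x).
  { intros x; apply (continuous_comp (fun y => S y ^ 2 + sigma ^ 2) sqrt).
    - apply continuous_Rplus; [|apply continuous_const].
      apply (continuous_comp S (fun t => t ^ 2)); [apply CS|].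
      apply (ex_derive_continuous (fun t => t ^ 2)); auto_derive; exact I.
    - apply continuous_sqrt. }
  assert (Cpsi : C1 psi).
  { apply (C1_intro _ _ Dpsi); intros x; unfold psi'.
    apply continuous_Rminus; [|apply continuous_const].
    apply continuous_Rmult.
    - apply (continuous_opp (fun y => S y / q y)).
      apply continuous_Rmult; [apply CS|].
      apply continuous_comp; [apply Cq|].
      apply (ex_derive_continuous (fun t => / t)); auto_derive.
      pose proof (Hq0 x); lra.
    - apply continuous_Rminus; [apply continuous_speed, HcF|apply continuous_const]. }
  destruct (continuous_min (fun y => v y - psi y) (x0 - 1) (x0 + 1)) as [y [Hy Hmin]]; [lra| |].
  { intros x; apply continuous_Rminus; [apply Hcv|].
    eapply continuous_of_is_derive, Dpsi. }
  assert (E0 : S x0 = 0) by (unfold S; ring).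
  assert (E1 : S (x0 + 1) = c_plus F - eta).
  { unfold S; rewrite (action_shift F HpF HcF); ring. }
  assert (E2 : S (x0 - 1) = - (c_plus F - eta)).
  { unfold S; pose proof (action_shift F HpF HcF (x0 - 1)) as E.
    replace (x0 - 1 + 1) with x0 in E by ring; rewrite E; ring. }
  assert (Q0 : q x0 = sigma).
  { unfold q; rewrite E0, pow_i, Rplus_0_l by lia; apply sqrt_pow2; lra. }
  pose proof (Hq (x0 + 1)) as Q1; pose proof (Hq (x0 - 1)) as Q2.
  pose proof (Rabs_pos c).
  rewrite E1, Rabs_pos_eq in Q1 by lra; rewrite E2, Rabs_Ropp, Rabs_pos_eq in Q2 by lra.
  pose proof (Hpv x0) as V1; pose proof (Hpv (x0 - 1)) as V2.
  replace (x0 - 1 + 1) with x0 in V2 by ring.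
  pose proof (Hmin x0 ltac:(lra)) as Hm0; simpl in Hm0.
  pose proof (Rle_abs c); pose proof (Rle_abs (- c)) as Hc'; rewrite Rabs_Ropp in Hc'.
  (* At [x0 + 1] and [x0 - 1] the function [v] repeats its value, while
     [q >= |S| = c_plus F - eta > |c| + sigma]; hence [v - psi] is larger there than at [x0]. *)
  assert (Hy1 : y <> x0 + 1) by (intros ->; unfold psi in Hm0; lra).
  assert (Hy2 : y <> x0 - 1) by (intros ->; unfold psi in Hm0; lra).
  exists y; repeat split.
  - destruct Hy as [[?|?] _]; [assumption|congruence].
  - destruct Hy as [_ [?|?]]; [assumption|congruence].
  - assert (HG := Hsup psi y Cpsi).
    rewrite (is_derive_unique psi y _ (Dpsi y)) in HG.
    unfold G_disc in HG.
    (* The term [c] cancels, and [|S| <= q] leaves a factor of modulus at most 1. *)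
    assert (Hsl : (c + psi' y) ^ 2 <= (speed F y - eta) ^ 2).
    { replace ((c + psi' y) ^ 2) with ((S y / q y) ^ 2 * (speed F y - eta) ^ 2)
        by (unfold psi'; ring).
      rewrite <- (Rmult_1_l ((speed F y - eta) ^ 2)) at 2.
      apply Rmult_le_compat_r; [apply pow2_ge_0|].
      rewrite <- pow2_abs; replace 1 with (1 ^ 2) by ring; apply pow_incr; split.
      - apply Rabs_pos.
      - pose proof (Hq0 y). unfold Rdiv; rewrite Rabs_mult, (Rabs_pos_eq (/ q y)).
        + apply Rmult_le_reg_r with (q y); [assumption|].
          rewrite Rmult_assoc, Rinv_l, Rmult_1_l, Rmult_1_r by lra; apply Hq.
        + left; apply Rinv_0_lt_compat; assumption. }
    assert (0 <= eps * v y + / 2 * (c + psi' y) ^ 2 - F y); [|lra].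
    apply HG.
    exists (Rmin (y - (x0 - 1)) (x0 + 1 - y)); split.
    + apply Rmin_pos; destruct Hy as [[?|?] [?|?]]; try congruence; lra.
    + intros t Ht; apply Hmin.
      pose proof (Rmin_l (y - (x0 - 1)) (x0 + 1 - y)).
      pose proof (Rmin_r (y - (x0 - 1)) (x0 + 1 - y)).
      apply Rabs_def2 in Ht; lra.
  - pose proof (Hq y) as Qy; unfold psi in Hm0; unfold S in Qy; lra.
Qed.

(** * Bounds on subsolutions from above at and around zeros of [F] *)

(** If [v z > 0], then [eps v - F > 0] near [z], so the subsolution inequality fails there for every
    slope; yet some test function always touches [v] from above near [z]. *)
Lemma nonpos_at_zero (F : R -> R) c eps (v : R -> R) z :
  (forall x : R, continuous F x) -> visc_sol_T (G_disc F c eps) v ->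
  0 < eps -> F z = 0 -> v z <= 0.
Proof.
  intros HcF (_ & Hcv & Hsub & _) Heps Hz.
  apply Rnot_lt_le; intros Hv.
  destruct (continuous_near (fun y => eps * v y - F y) z (eps * v z)) as [r [Hr Hn]].
  - apply continuous_Rminus; [|apply HcF].
    apply continuous_Rmult; [apply continuous_const|apply Hcv].
  - apply Rmult_lt_0_compat; assumption.
  - set (M := - ((Rabs (v (z + r / 3) - v z) + 1) / (r / 3))).
    destruct (touch_right v (fun y => M * (y - z)) (fun _ => M) z (z + r / 3) (r / 3) (v z))
      as (psi & x & C & Hx & Hmax & _ & _); try lra.
    + exact Hcv.
    + intros x; auto_derive; [exact I|ring].
    + intros x; apply continuous_const.
    + replace (M * (z + r / 3 - z)) with (- (Rabs (v (z + r / 3) - v z) + 1))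
        by (unfold M; field; lra).
      pose proof (Rle_abs (- (v (z + r / 3) - v z))) as H; rewrite Rabs_Ropp in H; lra.
    + pose proof (Hsub psi x C Hmax) as HG; unfold G_disc in HG.
      pose proof (pow2_ge_0 (c + Derive psi x)).
      assert (Hxz : Rabs (x - z) < r) by (apply Rabs_def1; lra).
      specialize (Hn x Hxz); apply Rabs_def2 in Hn; lra.
Qed.

(** A touching slope [p] with [|p| > L] gives [(c + p)^2 >= (L - |c|)^2 > 2 F], impossible for a
    subsolution where [v > 0]. The cone may start at height 0 because [v z <= 0]. *)
Lemma sub_cone (F : R -> R) c eps (v : R -> R) L z :
  (forall x : R, continuous F x) -> visc_sol_T (G_disc F c eps) v ->
  0 < eps -> F z = 0 -> Rabs c <= L -> (forall x, 2 * F x < (L - Rabs c) ^ 2) ->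
  forall x, v x <= L * Rabs (x - z).
Proof.
  intros HcF Hsol Heps Hz HL HF x.
  pose proof (nonpos_at_zero _ _ _ _ _ HcF Hsol Heps Hz) as Hvz.
  destruct Hsol as (_ & Hcv & Hsub & _).
  pose proof (Rabs_pos c).
  pose proof (Rle_abs c); pose proof (Rle_abs (- c)) as Hc'; rewrite Rabs_Ropp in Hc'.
  apply Rnot_lt_le; intros Hx.
  destruct (Rtotal_order z x) as [Hlt|[->|Hlt]].
  - rewrite Rabs_pos_eq in Hx by lra.
    destruct (touch_right v (fun y => L * (y - z)) (fun _ => L) z x 1 0)
      as (psi & y & C & Hy & Hmax & Hs & Hm); try lra.
    + exact Hcv.
    + intros t; auto_derive; [exact I|ring].
    + intros t; apply continuous_const.
    + pose proof (Hsub psi y C Hmax) as HG; unfold G_disc in HG.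
      assert (0 < v y) by (assert (0 <= L * (y - z)) by (apply Rmult_le_pos; lra); lra).
      assert (0 < eps * v y) by (apply Rmult_lt_0_compat; assumption).
      assert ((L - Rabs c) ^ 2 <= (c + Derive psi y) ^ 2) by (apply pow_incr; lra).
      specialize (HF y); lra.
  - rewrite Rminus_diag, Rabs_R0 in Hx; lra.
  - rewrite Rabs_left in Hx by lra.
    destruct (touch_left v (fun y => - L * (y - z)) (fun _ => - L) z x 1 0)
      as (psi & y & C & Hy & Hmax & Hs & Hm); try lra.
    + exact Hcv.
    + intros t; auto_derive; [exact I|ring].
    + intros t; apply continuous_const.
    + pose proof (Hsub psi y C Hmax) as HG; unfold G_disc in HG.
      assert (0 < v y) by (assert (0 <= L * (z - y)) by (apply Rmult_le_pos; lra); lra).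
      assert (0 < eps * v y) by (apply Rmult_lt_0_compat; assumption).
      assert ((L - Rabs c) ^ 2 <= (- (c + Derive psi y)) ^ 2) by (apply pow_incr; lra).
      specialize (HF y); lra.
Qed.

(** * Linear growth of [speed F] away from finitely many zeros *)

(** Compactness of [[a, b]] as a gluing principle: the supremum of the points reachable from [a] is
    reached, and cannot be smaller than [b]. *)
Lemma interval_induction (P : R -> R -> Prop) :
  (forall x, exists r, 0 < r /\ forall a b, x - r < a -> a <= b -> b < x + r -> P a b) ->
  (forall a b c, a <= b <= c -> P a b -> P b c -> P a c) ->
  forall a b, a <= b -> P a b.
Proof.
  intros Hloc Htr a b Hab.
  destruct (completeness (fun x => a <= x <= b /\ P a x)) as [m [Hub Hlub]].
  - exists b; intros x [Hx _]; lra.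
  - exists a; split; [lra|].
    destruct (Hloc a) as [r [Hr H]]; apply H; lra.
  - assert (Ham : a <= m).
    { apply Hub; split; [lra|]. destruct (Hloc a) as [r [Hr H]]; apply H; lra. }
    assert (Hmb : m <= b) by (apply Hlub; intros x [Hx _]; lra).
    destruct (Hloc m) as [r [Hr H]].
    assert (exists x, m - r < x <= m /\ a <= x /\ P a x) as (x & Hx & Hax & HP).
    { apply NNPP; intros Hn.
      assert (m <= m - r); [|lra].
      apply Hlub; intros x [Hx HP].
      apply Rnot_lt_le; intros Hlt; apply Hn; exists x.
      assert (x <= m) by (apply Hub; split; assumption). repeat split; try lra; assumption. }
    assert (Ht : forall t, m <= t -> t <= b -> t < m + r -> P a t).
    { intros t H1 H2 H3; apply Htr with x; [lra|exact HP|apply H; lra]. }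
    destruct (Rlt_le_dec m b) as [Hlt|Hle].
    + exfalso.
      set (t := Rmin b (m + r / 2)).
      assert (Htm : m < t) by (apply Rmin_glb_lt; lra).
      pose proof (Rmin_l b (m + r / 2)); pose proof (Rmin_r b (m + r / 2)); fold t in H0, H1.
      assert (t <= m); [|lra].
      apply Hub; split; [lra|]; apply Ht; lra.
    + replace b with m by lra; apply Ht; lra.
Qed.

(** A zero of [F >= 0] is a minimum, so [Derive F a = 0]. With [h] the second derivative at [a], the
    difference quotient of [Derive F] exceeds [h / 2] near [a], so [F - h / 4 (y - a)^2] grows on
    both sides of [a]. *)
Lemma quadratic_growth_at_zero (F : R -> R) a :
  (forall x, ex_derive F x) -> (forall x, ex_derive (Derive F) x) ->
  (forall x, 0 <= F x) -> F a = 0 -> 0 < Derive_n F 2 a ->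
  exists k r, 0 < k /\ 0 < r /\ forall y, Rabs (y - a) < r -> k * (y - a) ^ 2 <= F y.
Proof.
  intros H1 H2 HF Ha Hpos.
  assert (D0 : Derive F a = 0).
  { assert (pr : derivable_pt F a) by (apply ex_derive_Reals_0, H1).
    rewrite <- (Derive_Reals F a pr).
    apply (deriv_minimum F (a - 1) (a + 1) a pr); try lra.
    intros x _ _; rewrite Ha; apply HF. }
  set (h := Derive_n F 2 a) in *.
  assert (HD : is_derive (Derive F) a h) by (apply Derive_correct, H2).
  apply is_derive_Reals in HD.
  destruct (HD (h / 2)) as [r Hr]; [lra|].
  set (f := fun y => F y - h / 4 * (y - a) ^ 2).
  set (f' := fun y => Derive F y - h / 2 * (y - a)).
  assert (Df : forall x : R, is_derive f x (f' x)).
  { intros x; apply (is_derive_minus F (fun y => h / 4 * (y - a) ^ 2)).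
    - apply Derive_correct, H1.
    - auto_derive; [exact I|]. simpl; field. }
  exists (h / 4), r; repeat split; [lra|apply cond_pos|].
  intros y Hy.
  destruct (MVT_is_derive f f' a y Df) as [x [Hx He]].
  assert (Hfx : 0 <= f' x * (y - a)).
  { destruct (Req_dec x a) as [->|Hxa].
    - unfold f'; rewrite D0; replace ((0 - h / 2 * (a - a)) * (y - a)) with 0 by ring; lra.
    - assert (Hxr : Rabs (x - a) <= Rabs (y - a)).
      { unfold Rmin, Rmax in Hx; destruct (Rle_dec a y).
        - rewrite !Rabs_pos_eq; lra.
        - rewrite !Rabs_left1; lra. }
      specialize (Hr (x - a) ltac:(lra) ltac:(lra)).
      replace (a + (x - a)) with x in Hr by ring; rewrite D0, Rminus_0_r in Hr.
      apply Rabs_def2 in Hr.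
      assert (Hq : h / 2 < Derive F x / (x - a)) by lra.
      assert (E : f' x = (x - a) * (Derive F x / (x - a) - h / 2)) by (unfold f'; field; lra).
      rewrite E; clear E.
      assert (Hs : 0 <= (x - a) * (y - a)).
      { unfold Rmin, Rmax in Hx; destruct (Rle_dec a y).
        - apply Rmult_le_pos; lra.
        - replace ((x - a) * (y - a)) with ((a - x) * (a - y)) by ring.
          apply Rmult_le_pos; lra. }
      replace ((x - a) * (Derive F x / (x - a) - h / 2) * (y - a))
        with ((x - a) * (y - a) * (Derive F x / (x - a) - h / 2)) by ring.
      apply Rmult_le_pos; lra. }
  rewrite <- He in Hfx; unfold f in Hfx; rewrite Ha in Hfx.
  replace (h / 4 * (a - a) ^ 2) with 0 in Hfx by ring; lra.
Qed.

(** Quadratic growth of [F] holds locally and is glued over [[a, b]] by taking the smaller constant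
    and concatenating the lists; the square root makes it linear growth of [speed F]. *)
Lemma speed_growth (F : R -> R) z0 a b :
  (forall x, ex_derive F x) -> (forall x, ex_derive (Derive F) x) ->
  (forall x, 0 <= F x) -> (forall x, F x = 0 -> 0 < Derive_n F 2 x) ->
  F z0 = 0 -> a <= b ->
  exists kap l, 0 < kap /\ (forall z, In z l -> F z = 0) /\
    forall y, a <= y <= b -> exists z, In z l /\ kap * Rabs (y - z) <= speed F y.
Proof.
  intros H1 H2 HF Hpos Hz0 Hab.
  assert (exists k l, 0 < k /\ (forall z, In z l -> F z = 0) /\
    forall y, a <= y <= b -> exists z, In z l /\ k * (y - z) ^ 2 <= F y)
    as (k & l & Hk & Hl & H).
  { revert a b Hab; apply interval_induction.
    - intros x; destruct (HF x) as [Hx|Hx].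
      + destruct (continuous_near F x (F x / 2)) as [r [Hr Hn]];
          [apply (ex_derive_continuous F), H1|lra|].
        set (d := Rabs (x - z0) + 1).
        assert (Hd : 0 < d) by (unfold d; pose proof (Rabs_pos (x - z0)); lra).
        exists (Rmin r 1); split; [apply Rmin_pos; lra|].
        pose proof (Rmin_l r 1); pose proof (Rmin_r r 1).
        intros a b Ha _ Hb.
        (* Near a point with [F x > 0] the given zero [z0] serves: [F y >= F x / 2] and
           [|y - z0| <= d]. *)
        exists (F x / 2 / d ^ 2), (z0 :: nil); repeat split.
        * apply Rdiv_lt_0_compat; [lra|apply pow_lt, Hd].
        * intros z [<-|[]]; exact Hz0.
        * intros y Hy; exists z0; split; [left; reflexivity|].
          assert (Hyx : Rabs (y - x) < Rmin r 1) by (apply Rabs_def1; lra).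
          specialize (Hn y ltac:(lra)); apply Rabs_def2 in Hn.
          apply Rle_trans with (F x / 2 / d ^ 2 * d ^ 2).
          -- apply Rmult_le_compat_l; [left; apply Rdiv_lt_0_compat; [lra|apply pow_lt, Hd]|].
             rewrite <- pow2_abs; apply pow_incr; split; [apply Rabs_pos|].
             replace (y - z0) with ((y - x) + (x - z0)) by ring.
             eapply Rle_trans; [apply Rabs_triang|unfold d; lra].
          -- replace (F x / 2 / d ^ 2 * d ^ 2) with (F x / 2) by (field; lra); lra.
      + destruct (quadratic_growth_at_zero F x) as (k & r & Hk & Hr & H); auto.
        exists r; split; [exact Hr|]; intros a b Ha _ Hb.
        exists k, (x :: nil); repeat split; [exact Hk| |].
        * intros z [<-|[]]; auto.
        * intros y Hy; exists x; split; [left; reflexivity|].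
          apply H, Rabs_def1; lra.
    - intros a b c Habc (k & l & Hk & Hl & H) (k' & l' & Hk' & Hl' & H').
      exists (Rmin k k'), (l ++ l'); repeat split.
      + apply Rmin_pos; assumption.
      + intros z Hz; apply in_app_or in Hz as [Hz|Hz]; auto.
      + intros y Hy; destruct (Rle_lt_dec y b) as [Hyb|Hyb].
        * destruct (H y ltac:(lra)) as [z [Hz Hle]]; exists z; split.
          -- apply in_or_app; left; exact Hz.
          -- eapply Rle_trans; [|exact Hle].
             apply Rmult_le_compat_r; [apply pow2_ge_0|apply Rmin_l].
        * destruct (H' y ltac:(lra)) as [z [Hz Hle]]; exists z; split.
          -- apply in_or_app; right; exact Hz.
          -- eapply Rle_trans; [|exact Hle].
             apply Rmult_le_compat_r; [apply pow2_ge_0|apply Rmin_r]. }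
  exists (sqrt (2 * k)), l; repeat split; [apply sqrt_lt_R0; lra|exact Hl|].
  intros y Hy; destruct (H y Hy) as [z [Hz Hle]]; exists z; split; [exact Hz|].
  rewrite <- (sqrt_pow2 (Rabs (y - z))) by apply Rabs_pos.
  rewrite <- sqrt_mult_alt by lra; apply sqrt_le_1_alt; rewrite pow2_abs; lra.
Qed.

(** * Lower bound for [v eps] *)

(** Let [s = speed F y] at the descent point [y]. Then [s^2 - (s - B eps)^2 <= 2 eps (v y) <= B eps
    s], which fails for [s > B eps]. So [y] lies within [B eps / kap] of a zero [z], and replacing
    [y] by [z] in the descent estimate costs [O(eps)]. *)
Lemma lower_bound (F : R -> R) c eps (v : R -> R) M kap l B x0 :
  periodic1 F -> (forall x : R, continuous F x) -> (forall x, 0 <= F x) ->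
  (forall x, speed F x <= M) -> 0 < kap -> (forall z, In z l -> F z = 0) ->
  (forall y, -4 <= y <= 4 -> exists z, In z l /\ kap * Rabs (y - z) <= speed F y) ->
  visc_sol_T (G_disc F c eps) v -> 0 < eps ->
  B = 2 * (c_plus F + M + 1) / kap ->
  Rabs c + eps < c_plus F - B * eps -> B * eps / kap <= 1 -> 0 <= x0 <= 1 ->
  exists z, F z = 0 /\ Rabs (x0 - z) <= 2 /\
    Rabs (action F x0 - action F z) - c * (x0 - z)
      - (B ^ 2 / 2 + (c_plus F + M) * (B / kap) + B + 1) * eps <= v x0.
Proof.
  intros HpF HcF HF HM Hk Hl Hgr Hsol Heps HB Hc Hsm Hx0.
  assert (HM0 : 0 <= M) by (eapply Rle_trans; [apply (sqrt_pos (2 * F 0))|apply HM]).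
  pose proof (c_plus_ge_0 F HpF HcF) as Hcp.
  assert (HBp : 0 < B) by (rewrite HB; apply Rdiv_lt_0_compat; lra).
  assert (HBe : 0 < B * eps) by (apply Rmult_lt_0_compat; assumption).
  pose proof (Rabs_pos c).
  destruct (descent_point F c eps v (B * eps) eps x0 HpF HcF Hsol Heps Hc)
    as (y & Hy & Hvy & Hdy).
  destruct (Hgr y ltac:(lra)) as (z & Hz & Hyz).
  pose proof (Hl z Hz) as Fz.
  (* This slope is admissible because [|c| < c_plus F] leaves more than [M + 1], which exceeds
     [speed F]. *)
  assert (Hcone : v y <= (c_plus F + M + 1) * Rabs (y - z)).
  { apply (sub_cone F c eps v); try assumption; [lra|].
    intros t; rewrite <- (speed_sqr F t (HF t)).
    assert (0 <= speed F t) by apply sqrt_pos; specialize (HM t).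
    apply Rle_lt_trans with (M ^ 2); [apply pow_incr; lra|].
    assert ((M + 1) ^ 2 <= (c_plus F + M + 1 - Rabs c) ^ 2) by (apply pow_incr; lra).
    nra. }
  set (s := speed F y) in *.
  assert (Hs0 : 0 <= s) by apply sqrt_pos.
  (* [B] is chosen to absorb the slope of the cone and the growth constant [kap]. *)
  assert (Hv2 : 2 * v y <= B * s).
  { apply Rle_trans with (B * (kap * Rabs (y - z))).
    - replace (B * (kap * Rabs (y - z))) with (2 * ((c_plus F + M + 1) * Rabs (y - z)))
        by (rewrite HB; field; lra); lra.
    - apply Rmult_le_compat_l; lra. }
  assert (Hs2 : 2 * F y = s ^ 2) by (symmetry; apply speed_sqr, HF).
  rewrite Hs2 in Hvy.
  assert (Hse : s <= B * eps).
  { apply Rnot_lt_le; intros Hlt.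
    assert (2 * eps * v y <= s * (B * eps)).
    { replace (s * (B * eps)) with (eps * (B * s)) by ring.
      replace (2 * eps * v y) with (eps * (2 * v y)) by ring.
      apply Rmult_le_compat_l; lra. }
    assert (s * (B * eps) < s ^ 2 - (s - B * eps) ^ 2) by nra. lra. }
  (* From [s^2 - (s - B eps)^2 = B eps (2 s - B eps) >= - (B eps)^2]. *)
  assert (Hvlow : - (B ^ 2 / 2 * eps) <= v y).
  { assert (- (B * eps) ^ 2 <= 2 * eps * v y) by nra.
    apply Rmult_le_reg_l with (2 * eps); [lra|].
    replace (2 * eps * - (B ^ 2 / 2 * eps)) with (- (B * eps) ^ 2) by field; lra. }
  assert (Hd : Rabs (y - z) <= B / kap * eps).
  { apply Rmult_le_reg_l with kap; [lra|].
    replace (kap * (B / kap * eps)) with (B * eps) by (field; lra); lra. }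
  assert (Hd1 : Rabs (y - z) <= 1) by (replace (B / kap * eps) with (B * eps / kap) in Hd by (field; lra); lra).
  exists z; split; [exact Fz|split].
  { apply Rabs_le_between in Hd1; apply Rabs_le; lra. }
  assert (Hact : Rabs (action F x0 - action F z) - M * Rabs (y - z) - B * eps
     <= Rabs (action F y - action F x0 - B * eps * (y - x0))).
  { pose proof (action_lipschitz F M HcF HM y z) as HL.
    replace (action F x0 - action F z) with
      (- (action F y - action F x0 - B * eps * (y - x0)) + (action F y - action F z)
        + B * eps * (x0 - y)) by ring.
    pose proof (Rabs_triang (- (action F y - action F x0 - B * eps * (y - x0)) + (action F y - action F z))
       (B * eps * (x0 - y))) as T1.
    pose proof (Rabs_triang (- (action F y - action F x0 - B * eps * (y - x0))) (action F y - action F z)) as T2.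
    rewrite Rabs_Ropp in T2.
    assert (Rabs (B * eps * (x0 - y)) <= B * eps).
    { rewrite Rabs_mult, (Rabs_pos_eq (B * eps)) by lra.
      rewrite <- (Rmult_1_r (B * eps)) at 2; apply Rmult_le_compat_l; [lra|].
      apply Rabs_le; lra. }
    lra. }
  assert (Hcz : - (c_plus F * Rabs (y - z)) <= c * (y - z)).
  { assert (Rabs (c * (y - z)) <= c_plus F * Rabs (y - z)).
    { rewrite Rabs_mult; apply Rmult_le_compat_r; [apply Rabs_pos|lra]. }
    apply Rabs_le_between in H0; lra. }
  assert ((c_plus F + M) * Rabs (y - z) <= (c_plus F + M) * (B / kap * eps))
    by (apply Rmult_le_compat_l; lra).
  lra.
Qed.

(** * Logarithmic barrier and upper bound for [v eps] *)

(** Equal to [arsinh (t / sqrt e) + ln e / 2], with derivative [1 / sqrt (t^2 + e)]. *)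
Definition log_barrier (e t : R) : R := ln (t + sqrt (t ^ 2 + e)).

Definition barrier (e : R) (l : list R) (y : R) : R :=
  fold_right (fun z acc => log_barrier e (y - z) + acc) 0 l.

Definition barrier' (e : R) (l : list R) (y : R) : R :=
  fold_right (fun z acc => / sqrt ((y - z) ^ 2 + e) + acc) 0 l.

Lemma sqrt_gt_abs e t : 0 < e -> Rabs t < sqrt (t ^ 2 + e).
Proof.
  intros He; rewrite <- (sqrt_pow2 (Rabs t)) by apply Rabs_pos.
  rewrite pow2_abs; apply sqrt_lt_1_alt; split; [apply pow2_ge_0|lra].
Qed.

Lemma log_barrier_pos e t : 0 < e -> 0 < t + sqrt (t ^ 2 + e).
Proof.
  intros He; pose proof (sqrt_gt_abs e t He).
  pose proof (Rle_abs (- t)) as H'; rewrite Rabs_Ropp in H'; lra.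
Qed.

Lemma is_derive_barrier e l : 0 < e -> forall y : R, is_derive (barrier e l) y (barrier' e l y).
Proof.
  intros He y; induction l as [|z l IH]; simpl.
  - apply @is_derive_const.
  - apply (is_derive_plus (fun y => log_barrier e (y - z)) (barrier e l)); [|exact IH].
    unfold log_barrier.
    pose proof (log_barrier_pos e (y - z) He) as H1.
    pose proof (sqrt_gt_abs e (y - z) He) as H2; pose proof (Rabs_pos (y - z)).
    pose proof (pow2_ge_0 (y - z)).
    simpl in *; rewrite Rmult_1_r in *.
    auto_derive.
    + unfold Rminus in *; rewrite ?Rmult_1_r; repeat split; try lra.
    + unfold Rminus in *; rewrite ?Rmult_1_r; field; lra.
Qed.

Lemma continuous_barrier' e l : 0 < e -> forall y : R, continuous (barrier' e l) y.
Proof.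
  intros He y; induction l as [|z l IH]; simpl.
  - apply continuous_const.
  - apply continuous_Rplus; [|exact IH].
    apply (ex_derive_continuous (fun y => / sqrt ((y - z) * ((y - z) * 1) + e))).
    pose proof (sqrt_gt_abs e (y - z) He) as H2; pose proof (Rabs_pos (y - z)).
    pose proof (pow2_ge_0 (y - z)).
    simpl in *; rewrite Rmult_1_r in *.
    auto_derive; unfold Rminus in *; rewrite ?Rmult_1_r; repeat split; lra.
Qed.

Lemma barrier'_ge_0 e l y : 0 < e -> 0 <= barrier' e l y.
Proof.
  intros He; induction l as [|z l IH]; simpl; [lra|].
  pose proof (sqrt_gt_abs e (y - z) He); pose proof (Rabs_pos (y - z)).
  apply Rplus_le_le_0_compat; [|exact IH].
  left; apply Rinv_0_lt_compat; simpl in *; lra.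
Qed.

Lemma barrier'_ge e l y z : 0 < e -> In z l -> / sqrt ((y - z) ^ 2 + e) <= barrier' e l y.
Proof.
  intros He; induction l as [|z' l IH]; [intros []|intros [->|Hz]]; cbn [barrier' fold_right];
    fold (barrier' e l y).
  - pose proof (barrier'_ge_0 e l y He); lra.
  - pose proof (sqrt_gt_abs e (y - z') He); pose proof (Rabs_pos (y - z')).
    assert (0 < / sqrt ((y - z') ^ 2 + e)) by (apply Rinv_0_lt_compat; lra).
    specialize (IH Hz); lra.
Qed.

(** With [q = sqrt (t^2 + e)], the identity [(t + q) (q - t) = e] turns the upper bound on [q - t]
    into a lower bound on [t + q]. *)
Lemma log_barrier_bound e t r :
  0 < e <= 1 -> Rabs t <= r -> ln e - ln (2 * r + 1) <= log_barrier e t <= ln (2 * r + 1).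
Proof.
  intros He Ht; unfold log_barrier.
  pose proof (log_barrier_pos e t ltac:(lra)) as H1.
  pose proof (sqrt_gt_abs e t ltac:(lra)) as H2; pose proof (Rabs_pos t) as H3.
  assert (H4 : sqrt (t ^ 2 + e) <= r + 1).
  { rewrite <- (sqrt_pow2 (r + 1)) by lra; apply sqrt_le_1_alt.
    rewrite <- pow2_abs; assert (Rabs t ^ 2 <= r ^ 2) by (apply pow_incr; lra); nra. }
  assert (H5 : sqrt (t ^ 2 + e) ^ 2 = t ^ 2 + e) by (apply pow2_sqrt; pose proof (pow2_ge_0 t); lra).
  apply Rabs_le_between in Ht.
  split.
  - rewrite <- ln_div by lra; apply ln_le; [apply Rdiv_lt_0_compat; lra|].
    apply Rmult_le_reg_r with (2 * r + 1); [lra|].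
    replace (e / (2 * r + 1) * (2 * r + 1)) with e by (field; lra).
    replace e with ((t + sqrt (t ^ 2 + e)) * (sqrt (t ^ 2 + e) - t)) at 1 by (ring_simplify; lra).
    apply Rmult_le_compat_l; lra.
  - apply ln_le; lra.
Qed.

(** The oscillation of the barrier is the source of the logarithm in the rate. *)
Lemma barrier_bound (l : list R) :
  exists Q, 0 <= Q /\ forall e x y, 0 < e <= 1 -> -4 <= x <= 4 -> -4 <= y <= 4 ->
    Rabs (barrier e l x - barrier e l y) <= Q * (1 - ln e).
Proof.
  induction l as [|z l (Q & HQ & IH)].
  - exists 0; split; [lra|]; intros; simpl; rewrite Rminus_diag, Rabs_R0; lra.
  - set (r := Rabs z + 4).
    assert (Hr : 0 <= ln (2 * r + 1)).
    { pose proof (Rabs_pos z); rewrite <- ln_1; apply ln_le; unfold r; lra. }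
    exists (2 * ln (2 * r + 1) + 1 + Q); split; [lra|].
    intros e x y He Hx Hy; specialize (IH e x y He Hx Hy); simpl.
    fold (barrier e l x) (barrier e l y).
    assert (Hln : ln e <= 0) by (rewrite <- ln_1; apply ln_le; lra).
    assert (Hb : forall t, -4 <= t <= 4 -> Rabs (t - z) <= r).
    { intros t Ht; unfold r; pose proof (Rle_abs z); pose proof (Rle_abs (- z)) as H'.
      rewrite Rabs_Ropp in H'; apply Rabs_le; lra. }
    pose proof (log_barrier_bound e (x - z) r He (Hb x Hx)).
    pose proof (log_barrier_bound e (y - z) r He (Hb y Hy)).
    apply Rabs_le_between in IH; apply Rabs_le.
    assert (0 <= ln (2 * r + 1) * - ln e) by (apply Rmult_le_pos; lra).
    lra.
Qed.

(* With [t = |y - z|] and [w = 1 / sqrt (t^2 + eps)], the correction [eps D w] to the slope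
   gains [2 kap t eps D w] far from the zero [z] and [(eps D w)^2] close to it. *)
Lemma barrier_slope (F : R -> R) eps K D kap l y z :
  0 <= F y -> 0 < eps -> 0 < kap -> 0 < D -> K < kap * D -> 2 * K < D ^ 2 ->
  In z l -> kap * Rabs (y - z) <= speed F y ->
  2 * F y + 2 * eps * K < (speed F y + eps * D * barrier' eps l y) ^ 2.
Proof.
  intros HF Heps Hk HD HK1 HK2 Hz Hgr.
  pose proof (barrier'_ge eps l y z Heps Hz) as Hb.
  pose proof (sqrt_gt_abs eps (y - z) Heps) as Hq.
  set (q := sqrt ((y - z) ^ 2 + eps)) in *.
  set (t := Rabs (y - z)) in *.
  assert (Ht : 0 <= t) by apply Rabs_pos.
  assert (Hq2 : q ^ 2 = t ^ 2 + eps).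
  { unfold t; rewrite pow2_abs; apply pow2_sqrt; pose proof (pow2_ge_0 (y - z)); lra. }
  set (w := / q) in *.
  assert (Hw : 0 < w) by (apply Rinv_0_lt_compat; lra).
  assert (Hwq : w * q = 1) by (apply Rinv_l; lra).
  set (s := speed F y) in *.
  assert (Hs : 2 * F y = s ^ 2) by (symmetry; apply speed_sqr, HF).
  rewrite Hs.
  assert (He : 0 < eps * D) by (apply Rmult_lt_0_compat; assumption).
  assert (Hs0 : 0 <= s) by apply sqrt_pos.
  assert (Hew : 0 < eps * D * w) by (apply Rmult_lt_0_compat; assumption).
  apply Rlt_le_trans with ((s + eps * D * w) ^ 2).
  2:{ apply pow_incr; split; [lra|].
      apply Rplus_le_compat_l, Rmult_le_compat_l; lra. }
  (* [tau = t^2 / (t^2 + eps)] interpolates between the two regimes: [K < kap D] is used with weight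
     [tau], and [K < D^2 / 2] with weight [1 - tau = eps w^2]. *)
  set (tau := (t * w) ^ 2).
  assert (Htw : 0 <= t * w < 1).
  { split; [apply Rmult_le_pos; lra|].
    rewrite <- Hwq, (Rmult_comm t); apply Rmult_lt_compat_l; lra. }
  assert (Htau : eps * w ^ 2 = 1 - tau).
  { unfold tau; replace 1 with ((w * q) ^ 2) by (rewrite Hwq; ring).
    rewrite !Rpow_mult_distr, Hq2; ring. }
  assert (Htau1 : 0 <= tau <= t * w /\ tau < 1).
  { unfold tau; repeat split; nra. }
  assert (Hm : K < kap * D * (t * w) + D ^ 2 / 2 * (1 - tau)).
  { assert (kap * D * tau <= kap * D * (t * w)).
    { apply Rmult_le_compat_l; [|lra]. left; apply Rmult_lt_0_compat; assumption. }
    assert (K * tau <= kap * D * tau) by (apply Rmult_le_compat_r; lra).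
    assert (K * (1 - tau) < D ^ 2 / 2 * (1 - tau)) by (apply Rmult_lt_compat_r; lra).
    lra. }
  assert (Hst : kap * t * (eps * D * w) <= s * (eps * D * w)) by (apply Rmult_le_compat_r; lra).
  replace ((s + eps * D * w) ^ 2)
    with (s ^ 2 + 2 * (s * (eps * D * w)) + eps * D ^ 2 * (eps * w ^ 2)) by ring.
  rewrite Htau.
  apply (Rmult_lt_compat_l (2 * eps)) in Hm; [|lra].
  lra.
Qed.

(** Starting from [v z <= 0], [v] is compared with [Phi - c y] to the right of [z] and with
    [- Phi - c y] to the left, up to constants. A steeper touching slope [p] has [|c + p| >= h], and
    [h^2 > 2 F + 2 eps K] with [v >= - K] contradicts the subsolution inequality. *)
Lemma upper_bound (F : R -> R) c eps (v : R -> R) kap l K D x0 z :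
  (forall x : R, continuous F x) -> (forall x, 0 <= F x) ->
  0 < kap ->
  (forall y, -4 <= y <= 4 -> exists z, In z l /\ kap * Rabs (y - z) <= speed F y) ->
  visc_sol_T (G_disc F c eps) v -> 0 < eps ->
  (forall y, -4 <= y <= 4 -> - K <= v y) ->
  0 < D -> K < kap * D -> 2 * K < D ^ 2 ->
  0 <= x0 <= 1 -> F z = 0 -> Rabs (x0 - z) <= 2 ->
  v x0 <= Rabs (action F x0 - action F z) - c * (x0 - z)
    + eps * D * Rabs (barrier eps l x0 - barrier eps l z).
Proof.
  intros HcF HF Hk Hgr Hsol Heps HK HD HK1 HK2 Hx0 Fz Hz.
  pose proof (nonpos_at_zero _ _ _ _ _ HcF Hsol Heps Fz) as Hvz.
  destruct Hsol as (_ & Hcv & Hsub & _).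
  assert (HeD : 0 < eps * D) by (apply Rmult_lt_0_compat; assumption).
  apply Rabs_le_between in Hz.
  set (h := fun y => speed F y + eps * D * barrier' eps l y).
  assert (Hh : forall y p, -4 <= y <= 4 -> h y <= Rabs p -> 0 < eps * v y + / 2 * p ^ 2 - F y).
  { intros y p Hy Hp; destruct (Hgr y Hy) as (z' & Hz' & Hs).
    pose proof (barrier_slope F eps K D kap l y z' (HF y) Heps Hk HD HK1 HK2 Hz' Hs) as Hb.
    fold (h y) in Hb.
    assert (0 <= h y).
    { apply Rplus_le_le_0_compat; [apply sqrt_pos|].
      apply Rmult_le_pos; [lra|apply barrier'_ge_0, Heps]. }
    assert (h y ^ 2 <= p ^ 2) by (rewrite <- (pow2_abs p); apply pow_incr; lra).
    pose proof (Rmult_le_compat_l eps _ _ ltac:(lra) (HK y Hy)). lra. }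
  set (Phi := fun y => action F y + eps * D * barrier eps l y).
  assert (DPhi : forall y : R, is_derive Phi y (h y)).
  { intros y; apply (is_derive_plus (action F) (fun y => eps * D * barrier eps l y)).
    - apply is_derive_action, HcF.
    - apply (is_derive_scal (barrier eps l)), is_derive_barrier, Heps. }
  assert (Ch : forall y : R, continuous h y).
  { intros y; apply continuous_Rplus; [apply continuous_speed, HcF|].
    apply continuous_Rmult; [apply continuous_const|apply continuous_barrier', Heps]. }
  pose proof (Rle_abs (barrier eps l x0 - barrier eps l z)) as Hb1.
  pose proof (Rle_abs (- (barrier eps l x0 - barrier eps l z))) as Hb2; rewrite Rabs_Ropp in Hb2.
  apply (Rmult_le_compat_l (eps * D)) in Hb1; [|lra].
  apply (Rmult_le_compat_l (eps * D)) in Hb2; [|lra].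
  destruct (Rtotal_order z x0) as [Hlt|[->|Hlt]].
  - rewrite (Rabs_pos_eq (action F x0 - action F z))
      by (pose proof (action_le F HcF z x0); lra).
    apply Rnot_lt_le; intros Hx.
    destruct (touch_right v (fun y => Phi y - c * (y - z)) (fun y => h y - c)
       z x0 1 (- Phi z)) as (psi & y & C & Hy & Hmax & Hs & _); try lra; auto.
    + intros t; apply (is_derive_minus Phi (fun y => c * (y - z))); [apply DPhi|].
      auto_derive; [exact I|ring].
    + intros t; apply continuous_Rminus; [apply Ch|apply continuous_const].
    + unfold Phi; lra.
    + pose proof (Hsub psi y C Hmax) as HG; unfold G_disc in HG.
      pose proof (Rle_abs (c + Derive psi y)).
      pose proof (Hh y (c + Derive psi y) ltac:(lra) ltac:(lra)); lra.
  - rewrite !Rminus_diag, Rabs_R0; lra.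
  - rewrite (Rabs_left1 (action F x0 - action F z))
      by (pose proof (action_le F HcF x0 z); lra).
    apply Rnot_lt_le; intros Hx.
    destruct (touch_left v (fun y => - Phi y - c * (y - z)) (fun y => - h y - c)
       z x0 1 (Phi z)) as (psi & y & C & Hy & Hmax & Hs & _); try lra; auto.
    + intros t; apply (is_derive_minus (fun y => - Phi y) (fun y => c * (y - z))).
      * apply (is_derive_opp Phi), DPhi.
      * auto_derive; [exact I|ring].
    + intros t; apply continuous_Rminus; [apply (continuous_opp h), Ch|apply continuous_const].
    + unfold Phi; lra.
    + pose proof (Hsub psi y C Hmax) as HG; unfold G_disc in HG.
      pose proof (Rle_abs (- (c + Derive psi y))) as Hab; rewrite Rabs_Ropp in Hab.
      pose proof (Hh y (c + Derive psi y) ltac:(lra) ltac:(lra)); lra.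
Qed.

(** * The case where [F] has no zero *)

(* The list in [admissible_F] may lie outside [[0, 1)], so [F > 0] is allowed; then the
   effective Hamiltonian is negative and [v eps] blows up. *)
Lemma diverges_without_zero (F : R -> R) c (v : R -> R -> R) (vstar : R -> R) :
  periodic1 F -> (forall x : R, continuous F x) -> (forall x, 0 < F x) ->
  Rabs c < c_plus F ->
  (forall eps, 0 < eps -> visc_sol_T (G_disc F c eps) (v eps)) ->
  ~ (exists e0, 0 < e0 /\ forall eps, 0 < eps < e0 -> forall x, Rabs (v eps x - vstar x) < 1).
Proof.
  intros HpF HcF HF Hc Hsol (e0 & He0 & Hcv).
  destruct (continuous_min (speed F) (-1) 1) as (x1 & _ & Hmin);
    [lra|apply continuous_speed, HcF|].
  set (s0 := speed F x1) in *.
  assert (Hs0 : 0 < s0) by (apply sqrt_lt_R0; specialize (HF x1); lra).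
  destruct (Hsol (e0 / 2) ltac:(lra)) as (_ & Hc0 & _).
  destruct (continuous_max (v (e0 / 2)) (-1) 1) as (x2 & _ & Hmax); [lra|exact Hc0|].
  (* Any two [v eps] with [eps < e0] are within 1 of [vstar], hence within 2 of each other. *)
  set (V := Rabs (v (e0 / 2) x2) + 2).
  assert (HV : 0 < V) by (unfold V; pose proof (Rabs_pos (v (e0 / 2) x2)); lra).
  assert (HvV : forall eps y, 0 < eps < e0 -> -1 <= y <= 1 -> v eps y <= V).
  { intros eps y He Hy.
    pose proof (Hcv eps He y) as H1; pose proof (Hcv (e0 / 2) ltac:(lra) y) as H2.
    apply Rabs_def2 in H1; apply Rabs_def2 in H2; specialize (Hmax y Hy).
    unfold V; pose proof (Rle_abs (v (e0 / 2) x2)); lra. }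
  (* A third of the gap for [sigma] and at most a third for [eta] keep the inequality required by
     [descent_point] strict. *)
  set (g := (c_plus F - Rabs c) / 3).
  assert (Hg : 0 < g) by (unfold g; lra).
  set (eta := Rmin (s0 / 2) g).
  assert (Heta : 0 < eta) by (apply Rmin_pos; lra).
  pose proof (Rmin_l (s0 / 2) g) as He1; pose proof (Rmin_r (s0 / 2) g) as He2.
  fold eta in He1, He2.
  assert (Hse : 0 < s0 * eta) by (apply Rmult_lt_0_compat; assumption).
  (* Makes [2 eps V <= s0 eta / 2], whereas [s^2 - (s - eta)^2 >= 3 s0 eta / 2] for [s >= s0] and
     [eta <= s0 / 2]. *)
  set (eps := Rmin (e0 / 2) (s0 * eta / (4 * V))).
  assert (Heps : 0 < eps) by (apply Rmin_pos; [lra|apply Rdiv_lt_0_compat; lra]).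
  assert (Heps1 : eps <= e0 / 2) by apply Rmin_l.
  assert (Heps2 : eps * (4 * V) <= s0 * eta).
  { replace (s0 * eta) with (s0 * eta / (4 * V) * (4 * V)) by (field; lra).
    apply Rmult_le_compat_r; [lra|apply Rmin_r]. }
  destruct (descent_point F c eps (v eps) eta g 0 HpF HcF (Hsol eps Heps) Hg)
    as (y & Hy & Hvy & _); [unfold g in *; lra|].
  specialize (Hmin y ltac:(lra)).
  rewrite <- (speed_sqr F y) in Hvy by (left; apply HF).
  pose proof (HvV eps y ltac:(lra) ltac:(lra)) as Hle.
  apply (Rmult_le_compat_l (2 * eps)) in Hle; [|lra].
  nra.
Qed.

(** * Comparison of rates and passage to the limit *)

(** With [s = sqrt eps], the inequality [- ln s <= 1 / s - 1] bounds the left side by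
    [2 s - s^2]. *)
Lemma sqrt_log_bound eps : 0 < eps <= 1 -> eps * (1 - ln eps) <= 3 * sqrt eps.
Proof.
  intros He.
  set (s := sqrt eps).
  assert (Hs : 0 < s) by (apply sqrt_lt_R0; lra).
  assert (Hs2 : eps = s * s) by (symmetry; apply sqrt_sqrt; lra).
  assert (Hs1 : s <= 1) by (unfold s; rewrite <- sqrt_1; apply sqrt_le_1_alt; lra).
  assert (Hl : - ln s <= / s - 1).
  { rewrite <- ln_Rinv by exact Hs.
    assert (Hi : 0 < / s) by (apply Rinv_0_lt_compat; exact Hs).
    pose proof (exp_ineq1_le (ln (/ s))) as H; rewrite exp_ln in H by exact Hi; lra. }
  assert (Hss : s * / s = 1) by (apply Rinv_r; lra).
  rewrite Hs2, ln_mult by exact Hs.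
  apply (Rmult_le_compat_l (s * s)) in Hl; [|nra].
  nra.
Qed.

(** If [d <= sqrt eps], then [|ln d| >= |ln eps| / 2] and the squared logarithm dominates since
    [|ln eps| > 1]; otherwise [d > sqrt eps] dominates by itself. *)
Lemma log_rate_le eps d :
  0 < eps < exp (-1) -> 0 < d -> eps * (1 - ln eps) <= 8 * (eps * Rabs (ln d) ^ 2 + d).
Proof.
  intros He Hd.
  assert (He1 : eps < 1).
  { pose proof (exp_increasing (-1) 0 ltac:(lra)) as H; rewrite exp_0 in H; lra. }
  assert (Hl : ln eps < -1).
  { rewrite <- (ln_exp (-1)); apply ln_increasing; lra. }
  destruct (Rle_lt_dec d (sqrt eps)) as [Hds|Hds].
  - assert (Hld : ln d <= ln eps / 2).
    { replace (ln eps / 2) with (ln (sqrt eps)).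
      - apply ln_le; assumption.
      - assert (Hs : 0 < sqrt eps) by (apply sqrt_lt_R0; lra).
        rewrite <- (sqrt_sqrt eps) at 2 by lra; rewrite ln_mult by exact Hs; field. }
    rewrite Rabs_left by lra.
    assert ((- ln eps / 2) ^ 2 <= (- ln d) ^ 2) by (apply pow_incr; lra).
    assert (1 - ln eps <= 8 * (- ln d) ^ 2) by nra.
    apply (Rmult_le_compat_l eps) in H0; [|lra]. lra.
  - pose proof (sqrt_log_bound eps ltac:(lra)).
    pose proof (pow2_ge_0 (Rabs (ln d))).
    assert (0 <= eps * Rabs (ln d) ^ 2) by (apply Rmult_le_pos; lra). lra.
Qed.

Lemma limit_rate (C e1 : R) (v : R -> R) (vstar : R) (eps : R) :
  0 <= C -> 0 < e1 <= 1 -> 0 < eps < e1 ->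
  (forall e, 0 < e < e1 -> Rabs (v eps - v e) <= C * (eps * (1 - ln eps) + e * (1 - ln e))) ->
  (forall eta, 0 < eta -> exists e0, 0 < e0 /\
     forall e, 0 < e < e0 -> Rabs (v e - vstar) < eta) ->
  Rabs (v eps - vstar) <= C * (eps * (1 - ln eps)).
Proof.
  intros HC He1 Heps Hcau Hlim; apply le_epsilon; intros eta Heta.
  destruct (Hlim (eta / 2) ltac:(lra)) as (e0 & He0 & Hv).
  (* Chosen so that [e <= t^2] gives [C e (1 - ln e) <= 3 C t <= eta / 2]. *)
  set (t := eta / 2 / (3 * (C + 1))).
  assert (Ht : 0 < t) by (apply Rdiv_lt_0_compat; lra).
  set (e := Rmin (Rmin (e0 / 2) (e1 / 2)) (t ^ 2)).
  assert (Hep : 0 < e) by (repeat apply Rmin_pos; try lra; apply pow_lt, Ht).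
  assert (H1 : e <= e0 / 2 /\ e <= e1 / 2 /\ e <= t ^ 2).
  { pose proof (Rmin_l (Rmin (e0 / 2) (e1 / 2)) (t ^ 2)).
    pose proof (Rmin_r (Rmin (e0 / 2) (e1 / 2)) (t ^ 2)).
    pose proof (Rmin_l (e0 / 2) (e1 / 2)); pose proof (Rmin_r (e0 / 2) (e1 / 2)).
    unfold e; repeat split; lra. }
  specialize (Hv e ltac:(lra)); specialize (Hcau e ltac:(lra)).
  pose proof (sqrt_log_bound e ltac:(lra)) as Hs.
  assert (Hst : sqrt e <= t).
  { rewrite <- (sqrt_pow2 t) by lra; apply sqrt_le_1_alt; lra. }
  assert (HCt : C * (3 * t) <= eta / 2).
  { replace (eta / 2) with ((C + 1) * (3 * t)) by (unfold t; field; lra).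
    apply Rmult_le_compat_r; lra. }
  assert (C * (e * (1 - ln e)) <= C * (3 * t)) by (apply Rmult_le_compat_l; lra).
  replace (v eps - vstar) with ((v eps - v e) + (v e - vstar)) by ring.
  eapply Rle_trans; [apply Rabs_triang|]. lra.
Qed.

(** * Cauchy estimate with a constant uniform in [c] *)

(** The lower bound at [e'] provides a zero [z], and the upper bound at [e] is applied with the same
    [z], so the leading terms cancel. [C] is fixed before [c]; only the threshold [e1] depends on
    [c]. *)
Lemma uniform_cauchy_rate (F : R -> R) z0 :
  periodic1 F -> (forall x, ex_derive F x) -> (forall x, ex_derive (Derive F) x) ->
  (forall x, 0 <= F x) -> (forall x, F x = 0 -> 0 < Derive_n F 2 x) -> F z0 = 0 ->
  exists C, 0 <= C /\ forall c (v : R -> R -> R), Rabs c < c_plus F ->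
    (forall eps, 0 < eps -> visc_sol_T (G_disc F c eps) (v eps)) ->
    exists e1, 0 < e1 <= exp (-1) /\ forall e e', 0 < e < e1 -> 0 < e' < e1 -> forall x,
      v e x - v e' x <= C * (e * (1 - ln e) + e' * (1 - ln e')).
Proof.
  intros HpF H1 H2 HF Hpos Hz0.
  assert (HcF : forall x : R, continuous F x) by (intros x; apply (ex_derive_continuous F), H1).
  destruct (periodic1_bounded (speed F)) as [M HM].
  { intros x; unfold speed; rewrite HpF; reflexivity. }
  { apply continuous_speed, HcF. }
  assert (HM0 : 0 <= M) by (eapply Rle_trans; [apply (sqrt_pos (2 * F 0))|apply HM]).
  pose proof (c_plus_ge_0 F HpF HcF) as Hcp.
  (* The window [[-4, 4]] contains [[0, 1]], the zeros within distance 2 of it, and all descent and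
     touching points. *)
  destruct (speed_growth F z0 (-4) 4) as (kap & l & Hk & Hl & Hgr); try assumption; [lra|].
  destruct (barrier_bound l) as (Q & HQ & HbQ).
  remember (2 * (c_plus F + M + 1) / kap) as B eqn:EB.
  assert (HB : 0 < B) by (rewrite EB; apply Rdiv_lt_0_compat; lra).
  remember (B ^ 2 / 2 + (c_plus F + M) * (B / kap) + B + 1) as C3 eqn:EC3.
  assert (HC3 : 0 <= C3).
  { assert (0 <= (c_plus F + M) * (B / kap)).
    { apply Rmult_le_pos; [lra|]. left; apply Rdiv_lt_0_compat; assumption. }
    pose proof (pow2_ge_0 B); lra. }
  (* Uniform bound [v e >= - K]: [|c (x - z)| <= 2 c_plus F] and [C3 e <= C3]. Then [D] is taken
     large enough for both conditions of [barrier_slope]. *)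
  set (K := 2 * c_plus F + C3).
  set (D := 1 + 2 * K + K / kap).
  assert (HK : 0 <= K) by (unfold K; lra).
  assert (HKk : 0 <= K / kap) by (apply Rmult_le_pos; [exact HK|left; apply Rinv_0_lt_compat, Hk]).
  assert (HD : 1 <= D) by (unfold D; lra).
  assert (HD1 : K < kap * D).
  { unfold D; replace (kap * (1 + 2 * K + K / kap)) with (kap + 2 * (kap * K) + K) by (field; lra).
    pose proof (Rmult_le_pos _ _ (Rlt_le _ _ Hk) HK); lra. }
  assert (HD2 : 2 * K < D ^ 2).
  { apply Rlt_le_trans with D; [unfold D; lra|]. nra. }
  exists (C3 + D * Q); split.
  { apply Rplus_le_le_0_compat; [exact HC3|]; apply Rmult_le_pos; lra. }
  intros c v Hc Hsol.
  assert (Hexp : exp (-1) < 1).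
  { rewrite <- exp_0; apply exp_increasing; lra. }
  (* The last two terms give [|c| + e < c_plus F - B e] and [B e / kap <= 1], as [lower_bound]
     requires. *)
  set (e1 := Rmin (exp (-1)) (Rmin ((c_plus F - Rabs c) / (B + 1)) (kap / B))).
  assert (He1 : e1 <= exp (-1) /\ e1 <= (c_plus F - Rabs c) / (B + 1) /\ e1 <= kap / B).
  { pose proof (Rmin_l (exp (-1)) (Rmin ((c_plus F - Rabs c) / (B + 1)) (kap / B))).
    pose proof (Rmin_r (exp (-1)) (Rmin ((c_plus F - Rabs c) / (B + 1)) (kap / B))).
    pose proof (Rmin_l ((c_plus F - Rabs c) / (B + 1)) (kap / B)).
    pose proof (Rmin_r ((c_plus F - Rabs c) / (B + 1)) (kap / B)).
    unfold e1; repeat split; lra. }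
  exists e1; split.
  { split; [|apply He1]. repeat apply Rmin_pos; [apply exp_pos| |];
      apply Rdiv_lt_0_compat; lra. }
  assert (Hlow : forall e x, 0 < e < e1 -> 0 <= x <= 1 ->
    exists z, F z = 0 /\ Rabs (x - z) <= 2 /\
      Rabs (action F x - action F z) - c * (x - z) - C3 * e <= v e x).
  { intros e x He Hx; rewrite EC3.
    apply (lower_bound F c e (v e) M kap l B x); try assumption; try lra.
    - apply Hsol; lra.
    - assert (e * (B + 1) < c_plus F - Rabs c); [|lra].
      replace (c_plus F - Rabs c) with ((c_plus F - Rabs c) / (B + 1) * (B + 1)) by (field; lra).
      apply Rmult_lt_compat_r; lra.
    - apply Rmult_le_reg_r with (kap / B); [apply Rdiv_lt_0_compat; assumption|].
      replace (B * e / kap * (kap / B)) with e by (field; lra); lra. }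
  assert (HlowK : forall e y, 0 < e < e1 -> - K <= v e y).
  { intros e y He; destruct (integer_translate y) as [n Hn].
    destruct (Hsol e ltac:(lra)) as (Hpv & _).
    rewrite <- (periodic1_IZR (v e) Hpv n y).
    destruct (Hlow e (y + IZR n) He Hn) as (z & _ & Hz & Hle).
    assert (Hcz : Rabs (c * (y + IZR n - z)) <= c_plus F * 2).
    { rewrite Rabs_mult; apply Rmult_le_compat; try apply Rabs_pos; lra. }
    apply Rabs_le_between in Hcz.
    pose proof (Rabs_pos (action F (y + IZR n) - action F z)).
    assert (C3 * e <= C3 * 1) by (apply Rmult_le_compat_l; lra).
    unfold K; lra. }
  intros e e' He He' x.
  destruct (integer_translate x) as [n Hn].
  destruct (Hsol e ltac:(lra)) as (Hpv & _); destruct (Hsol e' ltac:(lra)) as (Hpv' & _).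
  rewrite <- (periodic1_IZR (v e) Hpv n x), <- (periodic1_IZR (v e') Hpv' n x).
  set (x0 := x + IZR n) in *.
  destruct (Hlow e' x0 He' Hn) as (z & Fz & Hz & Hle').
  assert (Hle := upper_bound F c e (v e) kap l K D x0 z HcF HF Hk Hgr (Hsol e ltac:(lra))
    ltac:(lra) (fun y _ => HlowK e y He) ltac:(lra) HD1 HD2 Hn Fz Hz).
  apply Rabs_le_between in Hz.
  pose proof (HbQ e x0 z ltac:(lra) ltac:(lra) ltac:(lra)) as Hb.
  apply (Rmult_le_compat_l (e * D)) in Hb; [|apply Rmult_le_pos; lra].
  assert (Hln : forall t, 0 < t < e1 -> t <= t * (1 - ln t)).
  { intros t Ht; rewrite <- (Rmult_1_r t) at 1; apply Rmult_le_compat_l; [lra|].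
    assert (ln t <= ln 1) by (apply ln_le; lra); rewrite ln_1 in *; lra. }
  pose proof (Hln e He) as L1; pose proof (Hln e' He') as L2.
  apply (Rmult_le_compat_l C3) in L2; [|exact HC3].
  assert (0 <= C3 * (e * (1 - ln e))) by (apply Rmult_le_pos; lra).
  assert (0 <= D * Q * (e' * (1 - ln e'))).
  { apply Rmult_le_pos; [apply Rmult_le_pos|specialize (Hln e' He')]; lra. }
  lra.
Qed.

(** * Convergence rate in terms of [delta] *)

Theorem theorem4p3 (F : R -> R) (alpha : R) (delta : R -> R) :
  admissible_F F ->
  0 < alpha ->
  (forall eps, 0 < eps -> 0 < delta eps) ->
  (forall eps, 0 < eps -> alpha * eps <= delta eps) ->
  (forall eta, 0 < eta -> exists e0, 0 < e0 /\
     forall eps, 0 < eps < e0 -> delta eps < eta) ->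
  exists beta, 0 < beta /\
    forall (c : R) (v : R -> R -> R) (vstar : R -> R),
      - c_plus F < c < c_plus F ->
      (forall eps, 0 < eps -> visc_sol_T (G_disc F c eps) (v eps)) ->
      (forall eta, 0 < eta -> exists e0, 0 < e0 /\
         forall eps, 0 < eps < e0 -> forall x, Rabs (v eps x - vstar x) < eta) ->
      exists e0, 0 < e0 /\
        forall eps, 0 < eps < e0 -> forall x,
          Rabs (v eps x - vstar x) <=
            beta * (eps * (Rabs (ln (delta eps))) ^ 2 + delta eps).
Proof.
  intros (HpF & H1 & H2 & _ & HF & _ & Hpos) _ Hdelta _ _.
  assert (HcF : forall x : R, continuous F x) by (intros x; apply (ex_derive_continuous F), H1).
  destruct (classic (exists z, F z = 0)) as [[z0 Hz0]|Hno].
  - destruct (uniform_cauchy_rate F z0 HpF H1 H2 HF Hpos Hz0) as (C & HC & Hrate).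
    (* The factor 8 comes from [log_rate_le]; adding 1 keeps [beta] positive when [C = 0]. *)
    exists (8 * (C + 1)); split; [lra|].
    intros c v vstar Hc Hsol Hlim.
    destruct (Hrate c v (Rabs_def1 _ _ (proj2 Hc) (proj1 Hc)) Hsol) as (e1 & He1 & Hcau).
    assert (Hexp : exp (-1) < 1) by (rewrite <- exp_0; apply exp_increasing; lra).
    exists e1; split; [lra|]; intros eps Heps x.
    assert (Hr := limit_rate C e1 (fun e => v e x) (vstar x) eps HC ltac:(lra) Heps).
    pose proof (log_rate_le eps (delta eps) ltac:(lra) (Hdelta eps ltac:(lra))) as Hd.
    assert (Rabs (v eps x - vstar x) <= C * (eps * (1 - ln eps))).
    { apply Hr.
      - intros e He; apply Rabs_le; split.
        + pose proof (Hcau e eps He Heps x); lra.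
        + apply Hcau; assumption.
      - intros eta Heta; destruct (Hlim eta Heta) as (e0 & He0 & Hv).
        exists e0; split; [exact He0|]; intros e He; apply Hv, He. }
    assert (0 <= eps * Rabs (ln (delta eps)) ^ 2 + delta eps).
    { apply Rplus_le_le_0_compat; [apply Rmult_le_pos; [lra|apply pow2_ge_0]|].
      left; apply Hdelta; lra. }
    apply (Rmult_le_compat_l C) in Hd; lra.
  (* Without a zero the assumed convergence is contradictory, so any positive [beta] serves. *)
  - exists 1; split; [lra|]; intros c v vstar Hc Hsol Hlim; exfalso.
    apply (diverges_without_zero F c v vstar); try assumption.
    + intros x; destruct (HF x) as [Hx|Hx]; [exact Hx|].
      exfalso; apply Hno; exists x; symmetry; exact Hx.
    + apply Rabs_def1; lra.
    + apply Hlim; lra.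
Qed.
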